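(* Let $C\subseteq\{0,1\}^n$ be a code with block length $n$ and minimal distance $d$. Let $B$ be a nonempty subset of $\{0,1\}^n$ with $\lambda_B\ge n-2d+1$. Then $$|C|\le n\,|B|.$$
   Context: A binary code with block length $n$ and minimal distance $d$ is a subset $C\subseteq\{0,1\}^n$ in which the Hamming distance between any two distinct points is at least $d$. Two elements $x,y\in\{0,1\}^n$ are adjacent (written $x\sim y$) if their Hamming distance is $1$; let $A$ be the adjacency matrix of the resulting graph on $\{0,1\}^n$, acting on functions by $(Af)(x)=\sum_{y\sim x}f(y)$. For nonempty $B\subseteq\{0,1\}^n$, define $$\lambda_B=\max\left\{\frac{\langle Af,f\rangle}{\langle f,f\rangle} : f:\{0,1\}^n\to\mathbb{R},\ f\neq 0,\ \mathrm{supp}(f)\subseteq B\right\},$$ where $\langle f,g\rangle = 2^{-n}\sum_x f(x)g(x)$; that is, $\lambda_B$ is the maximal eigenvalue of the adjacency matrix of the subgraph of the Hamming cube induced by $B$.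
   Formalization: The block length n is assumed positive, and the case n = 2d-1 with B a single point is excluded; there the bound can fail, e.g. n = d = 1, C = {0,1}, B = {0}, where λ_B = 0 = n-2d+1 but |C| = 2 > 1. *)

(* Defs.v *)
From HB Require Import structures.
From mathcomp Require Import all_boot all_order all_algebra.
From mathcomp Require Import all_classical all_reals all_analysis.
Set Implicit Arguments.
Unset Strict Implicit.
Unset Printing Implicit Defensive.
Import Order.TTheory GRing.Theory Num.Theory.
Import numFieldNormedType.Exports.
Local Open Scope ring_scope.

Definition cube (n : nat) : finType := {ffun 'I_n -> bool}.

Definition hamming (n : nat) (x y : cube n) : nat := #|[pred i | x i != y i]|.

Definition is_code (n d : nat) (C : {set cube n}) : Prop :=
  forall x y : cube n, x \in C -> y \in C -> x != y -> (d <= hamming x y)%N.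

Definition adjacent (n : nat) : rel (cube n) := fun x y => hamming x y == 1%N.

Definition adjop (R : realType) (n : nat) (f : {ffun cube n -> R}) :
    {ffun cube n -> R} :=
  [ffun x => \sum_(y | adjacent x y) f y].

Definition inner (R : realType) (n : nat) (f g : {ffun cube n -> R}) : R :=
  (2 ^+ n)^-1 * \sum_x f x * g x.

Definition rayleigh_quotients (R : realType) (n : nat) (B : {set cube n}) :
    set R :=
  [set q | exists f : {ffun cube n -> R},
     [/\ f != 0, {subset support f <= B} &
         q = inner (adjop f) f / inner f f]]%classic.
Arguments rayleigh_quotients R {n} B.

(* For B nonempty this supremum is a maximum: see [lambda_is_max]. For B empty
   it is the junk value 0. *)
Definition lambda (R : realType) (n : nat) (B : {set cube n}) : R :=
  sup (rayleigh_quotients R B).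
Arguments lambda R {n} B.

Section LambdaIsMax.
Variables (R : realType) (n : nat).
Implicit Types (f : {ffun cube n -> R}) (B : {set cube n}).
Let N := #|{: cube n}|.

Let fn (v : 'rV[R]_N) : {ffun cube n -> R} := [ffun x => v 0 (enum_rank x)].
Let vec f : 'rV[R]_N := \row_i f (enum_val i).

Let vecK f : fn (vec f) = f.
Proof. by apply/ffunP => x; rewrite ffunE mxE enum_rankK. Qed.

Let cont_fn x : continuous (fun v : 'rV[R]_N => fn v x).
Proof.
have -> : (fun v => fn v x) = (fun v : 'rV[R]_N => v 0 (enum_rank x)).
  by apply/funext => v; rewrite ffunE.
exact: coord_continuous.
Qed.

Let cont_adj x : continuous (fun v : 'rV[R]_N => adjop (fn v) x).
Proof.
have -> : (fun v => adjop (fn v) x)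
        = (fun v : 'rV[R]_N => \sum_(y | adjacent x y) fn v y).
  by apply/funext => v; rewrite ffunE.
apply: continuous_big => [|y _]; [exact: add_continuous | exact: cont_fn].
Qed.

Let cont_inner (F G : 'rV[R]_N -> {ffun cube n -> R}) :
  (forall x, continuous (fun v => F v x)) ->
  (forall x, continuous (fun v => G v x)) ->
  continuous (fun v => inner (F v) (G v)).
Proof.
move=> cF cG.
have cs : continuous (fun v => \sum_x F v x * G v x).
  apply: continuous_big => [|x _ v]; first exact: add_continuous.
  exact: (cvgM (cF x v) (cG x v)).
by move=> v; apply: cvgMl_tmp (cs v).
Qed.

Let innerZ a f : inner (a *: f) (a *: f) = a ^+ 2 * inner f f.
Proof.
rewrite /inner [RHS]mulrCA; congr (_ * _); rewrite mulr_sumr; apply: eq_bigr => x _.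
by rewrite !ffunE /= expr2 mulrACA.
Qed.

Let innerAZ a f : inner (adjop (a *: f)) (a *: f) = a ^+ 2 * inner (adjop f) f.
Proof.
rewrite /inner [RHS]mulrCA; congr (_ * _); rewrite mulr_sumr; apply: eq_bigr => x _.
rewrite !ffunE expr2 /= [RHS]mulrACA mulr_sumr; congr (_ * _).
by apply: eq_bigr => y _; rewrite ffunE.
Qed.

Let inner_ge f x : (2 ^+ n)^-1 * f x ^+ 2 <= inner f f.
Proof.
rewrite /inner ler_pM2l ?invr_gt0 ?exprn_gt0// (bigD1 x)//= -expr2 lerDl.
by apply: sumr_ge0 => y _; rewrite -expr2 sqr_ge0.
Qed.

Let inner_gt0 f : f != 0 -> 0 < inner f f.
Proof.
move=> f0; have [x fx] : exists x, f x != 0.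
  apply/existsP; apply: contraNT f0 => /existsPn h.
  by apply/eqP/ffunP => x; rewrite ffunE; apply/eqP; have := h x; rewrite negbK.
apply: lt_le_trans (inner_ge f x).
by apply: mulr_gt0; [rewrite invr_gt0 exprn_gt0 | rewrite exprn_even_gt0].
Qed.

Lemma lambda_is_max B : B != finset.set0 ->
  rayleigh_quotients R B (lambda R B) /\
  (forall q, rayleigh_quotients R B q -> q <= lambda R B).
Proof.
case/set0Pn => b bB.
pose K : set 'rV[R]_N := [set v | inner (fn v) (fn v) = 1 /\
   forall x, x \notin B -> fn v x = 0]%classic.
have unitK f : f != 0 -> {subset support f <= B} ->
    K (vec ((Num.sqrt (inner f f))^-1 *: f)).
  move=> f0 fB; have f1 := inner_gt0 f0; split.
    by rewrite vecK innerZ exprVn sqr_sqrtr ?ltW// mulVf ?gt_eqF.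
  move=> x xB; rewrite vecK ffunE /=.
  by have /eqP-> : f x == 0; [apply: contraNT xB => /fB | rewrite scaler0].
have d0 : [ffun x => (x == b)%:R] != 0 :> {ffun cube n -> R}.
  by apply/eqP => /ffunP/(_ b); rewrite !ffunE eqxx; apply/eqP/oner_neq0.
have dB : {subset support [ffun x => (x == b)%:R : R] <= B}.
  by move=> x; rewrite inE ffunE; case: (x =P b) => [->//|_]; rewrite eqxx.
have K0 : (K !=set0)%classic by eexists; exact: unitK d0 dB.
have cK : compact K.
  apply: bounded_closed_compact.
    exists (2 ^+ n); split; first exact: num_real.
    move=> M hM v [v1 _] /=.
    have M1 : 1 <= M by apply: le_trans (ltW hM); rewrite exprn_ege1// ler1n.
    rewrite [leLHS]mx_normrE; apply: bigmax_le => [|[i j] _]; first exact: le_trans M1.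
    rewrite ord1 /=; have := inner_ge (fn v) (enum_val j).
    rewrite v1 ffunE enum_valK mulrC ler_pdivrMr ?exprn_gt0// mul1r => h.
    rewrite -(ler_pXn2r (n:=2)) ?nnegrE ?(le_trans _ M1)//.
    rewrite real_normK ?num_real// (le_trans h)// (le_trans (ltW hM))//.
    by rewrite expr2 ler_peMl// (le_trans _ M1).
  have -> : K = ((fun v => inner (fn v) (fn v)) @^-1` [set 1%R] `&`
      \bigcap_(x in [set x | x \notin B]) ((fun v => fn v x) @^-1` [set 0%R]))%classic.
    by apply/seteqP; split => v [v1 v2]; split.
  apply: closedI.
    apply: (preimage_closed _ (@closed_eq _ _)) => v _.
    by apply: cont_inner => x; exact: cont_fn.
  apply: closed_bigI => x _.
  by apply: (preimage_closed _ (@closed_eq _ _)) => v _; exact: cont_fn.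
have [|c /[!inE] cK' cmax] := @EVT_max_rV R _
    (fun v => inner (adjop (fn v)) (fn v)) K K0 cK.
  apply: continuous_subspaceT.
  by apply: (@cont_inner (fun v => adjop (fn v)) fn) => x;
    [exact: cont_adj | exact: cont_fn].
have [c1 c2] := cK'.
have ub q : rayleigh_quotients R B q -> q <= inner (adjop (fn c)) (fn c).
  move=> [f [f0 fB ->]]; have f1 := inner_gt0 f0.
  have := cmax _ (mem_set (unitK f f0 fB)).
  by rewrite vecK innerAZ exprVn sqr_sqrtr ?(ltW f1)// mulrC.
have att : rayleigh_quotients R B (inner (adjop (fn c)) (fn c)).
  exists (fn c); split; last by rewrite c1 divr1.
    apply/eqP => c0; move: c1; rewrite c0 /inner big1 ?mulr0.
      by move/esym/eqP; rewrite oner_eq0.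
    by move=> x _; rewrite ffunE mul0r.
  by move=> x; rewrite inE; apply: contraNT => /c2->.
have hs : has_ubound (rayleigh_quotients R B) by eexists; exact: ub.
suff -> : lambda R B = inner (adjop (fn c)) (fn c) by [].
apply/le_anti/andP; split; last exact: ub_le_sup.
by apply: ge_sup => //; eexists; exact: att.
Qed.

End LambdaIsMax.

(* Main.v *)
(** With the characters [chi c], put [g c c' = \sum_x f x * chi c x * chi c' x] and
    [S = \sum_(c, c' in C) g c c' ^ 2 = \sum_(x, y) f x * f y * M x y], where the
    kernel [M x y = (\sum_(c in C) chi c x * chi c y) ^ 2] is nonnegative.
    If [f >= 0] lives on [B] and [A f >= l * f] pointwise, then applying [A] to one
    of the two factors gives
    [l * S <= \sum_(c, c' in C) (n - 2 * hamming c c') * g c c' ^ 2].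
    Splitting off the diagonal [c = c'], the right-hand side is at most
    [(n - 2d) * S + 2d * |C| * (\sum_x f x) ^ 2].  Keeping only the terms [x = y],
    [S >= |C| ^ 2 * \sum_x f x ^ 2], and Cauchy-Schwarz on [B] yields
    [(l - n + 2d) * |C| <= 2d * |B|].
    A maximiser of the Rayleigh quotient can be taken nonnegative and is then such
    an [f] with [l = lambda_B]; this settles [2d <= n].  For larger [d], a point
    mass with [l = 0] gives the Plotkin bound [(2d - n) * |C| <= 2d], which suffices
    (using [|B| >= 2] when [2d = n + 1]). *)

Require Import Defs.
From mathcomp Require Import all_boot all_order all_algebra.
From mathcomp Require Import all_classical all_reals all_analysis.
From mathcomp Require Import ring lra zify.
Import Order.TTheory GRing.Theory Num.Theory.
Local Open Scope ring_scope.

(** * Neighbours in the cube as coordinate flips *)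

Definition flip {n} (x : cube n) (i : 'I_n) : cube n :=
  [ffun j => (j == i) (+) x j].

Lemma flip_inj n (x : cube n) : injective (flip x).
Proof.
move=> i j /ffunP/(_ i); rewrite !ffunE eqxx.
by case: (i =P j) => // _; case: (x i).
Qed.

Lemma adjacentE n (x y : cube n) :
  Defs.adjacent x y = (y \in [set flip x i | i in 'I_n]).
Proof.
apply/idP/imsetP => [/eqP h|[i _ ->]].
  have /card1P [i hi] : #|[pred i | x i != y i]| == 1%N by rewrite -h.
  exists i => //; apply/ffunP => j; rewrite ffunE.
  by have := hi j; rewrite !inE => <-; case: (x j); case: (y j).
apply/card1P; exists i => j; rewrite !inE ffunE.
by case: (j == i); case: (x j).
Qed.

Lemma adjacent_sym n : symmetric (@Defs.adjacent n).
Proof.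
move=> x y; rewrite /Defs.adjacent /hamming; congr (_ == _).
by apply: eq_card => i; rewrite !inE eq_sym.
Qed.

Section Characters.
Variables (R : realType) (n : nat).
Implicit Types (c x y : cube n) (f g : {ffun cube n -> R}).

Lemma adjopE f x : adjop f x = \sum_i f (flip x i).
Proof.
rewrite ffunE (eq_bigl _ _ (adjacentE _ x)) big_imset //=.
by move=> i j _ _; exact: flip_inj.
Qed.

Lemma adjop_sym f g : \sum_x adjop f x * g x = \sum_x f x * adjop g x.
Proof.
under eq_bigr do rewrite ffunE mulr_suml.
under [RHS]eq_bigr do rewrite ffunE mulr_sumr.
rewrite (exchange_big_dep predT) //=.
by apply: eq_bigr => y _; apply: eq_bigl => x; rewrite adjacent_sym.
Qed.

(** * Characters and Fourier coefficients *)

Definition chi c x : R := \prod_i (-1) ^+ (c i && x i).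

Lemma chi_sqr c x : chi c x * chi c x = 1.
Proof.
by rewrite -big_split /= big1 // => i _; rewrite -signr_addb addbb.
Qed.

Lemma chi_flip c x i : chi c (flip x i) = (-1) ^+ (c i) * chi c x.
Proof.
rewrite /chi (bigD1 i) //= [in RHS](bigD1 i) //= mulrA; congr (_ * _).
  by rewrite -signr_addb ffunE eqxx; case: (c i); case: (x i).
by apply: eq_bigr => j /negPf ji; rewrite ffunE ji.
Qed.

Lemma sum_sign_hamming c c' :
  \sum_i (-1) ^+ (c i) * (-1) ^+ (c' i) = n%:R - 2 * (hamming c c')%:R :> R.
Proof.
rewrite /hamming -sum1_card natr_sum mulr_sumr.
rewrite [X in _ = _ - X](big_mkcond (fun i => i \in [pred i | c i != c' i])) /=.
rewrite -[in X in X - _](card_ord n) -sum1_card natr_sum -sumrB.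
apply: eq_bigr => i _; rewrite inE.
by case: (c i); case: (c' i); rewrite /= ?expr0 ?expr1; ring.
Qed.

(** The product of the two characters is the character of the sum of [c] and [c'] mod 2; flipping
    coordinate [i] changes its sign exactly when [c] and [c'] differ there. *)
Lemma chi_eigen c c' x :
  adjop [ffun y => chi c y * chi c' y] x
  = (n%:R - 2 * (hamming c c')%:R) * (chi c x * chi c' x).
Proof.
rewrite adjopE -sum_sign_hamming mulr_suml; apply: eq_bigr => i _.
by rewrite ffunE !chi_flip mulrACA.
Qed.

(** The unnormalised Fourier coefficient of [f] at the sum of [c] and [c'] mod 2. *)
Definition coef f c c' : R := \sum_x f x * (chi c x * chi c' x).

Lemma coef_adjop f c c' :
  coef (adjop f) c c' = (n%:R - 2 * (hamming c c')%:R) * coef f c c'.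
Proof.
have := adjop_sym f [ffun y => chi c y * chi c' y].
under eq_bigr do rewrite ffunE [X in _ * X]ffunE.
under [X in _ = X -> _]eq_bigr do rewrite chi_eigen mulrCA.
rewrite -mulr_sumr /coef => <-.
by apply: eq_bigr => x _; rewrite ffunE.
Qed.

Lemma coef_diag f c : coef f c c = \sum_x f x.
Proof. by apply: eq_bigr => x _; rewrite chi_sqr mulr1. Qed.

Definition kernel (C : {set cube n}) x y : R := (\sum_(c in C) chi c x * chi c y) ^+ 2.

(** Each summand splits into a factor in [c] and one in [c'], hence the square. Separate [f] and [g]
    let one kernel serve both [S] and its variant with [adjop f]. *)
Lemma sum_coefM (C : {set cube n}) f g :
  \sum_(c in C) \sum_(c' in C) coef f c c' * coef g c c'
  = \sum_x \sum_y f x * g y * kernel C x y.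
Proof.
transitivity (\sum_(c in C) \sum_(c' in C) \sum_x \sum_y
    f x * g y * ((chi c x * chi c y) * (chi c' x * chi c' y))).
  apply: eq_bigr => c _; apply: eq_bigr => c' _.
  rewrite mulr_suml; apply: eq_bigr => x _; rewrite mulr_sumr.
  by apply: eq_bigr => y _; ring.
under eq_bigr do rewrite exchange_big.
rewrite exchange_big; apply: eq_bigr => x _.
under eq_bigr do rewrite exchange_big.
rewrite exchange_big; apply: eq_bigr => y _.
rewrite /kernel expr2 mulr_suml mulr_sumr; apply: eq_bigr => c _.
by rewrite !mulr_sumr.
Qed.

(** * The size bound for codes *)

Lemma sum_sqr_gt0 f : f != 0 -> 0 < \sum_x f x ^+ 2.
Proof.
move=> f0; rewrite lt_neqAle sumr_ge0 ?andbT => [|x _]; last exact: sqr_ge0.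
apply: contraNneq f0 => /esym/eqP; rewrite psumr_eq0 => [/allP h|x _]; last exact: sqr_ge0.
apply/eqP/ffunP => x; rewrite ffunE; apply/eqP.
by have := h x (mem_index_enum x); rewrite /= sqrf_eq0.
Qed.

Lemma sqr_sum_le_card (B : {set cube n}) f : {subset support f <= B} ->
  (\sum_x f x) ^+ 2 <= #|B|%:R * \sum_x f x ^+ 2.
Proof.
move=> fB.
have f0 x : x \notin B -> f x = 0.
  by move=> xB; apply/eqP; apply: contraNT xB => /fB.
have restr (h : R -> R) : h 0 = 0 -> \sum_x h (f x) = \sum_(x in B) h (f x).
  move=> h0; rewrite [RHS]big_mkcond; apply: eq_bigr => x _.
  by case: ifPn => // /f0 ->.
rewrite (restr id) // (restr (fun t => t ^+ 2)) ?expr0n //.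
set s := \sum_(x in B) f x; set q := \sum_(x in B) _.
(* Lagrange's identity: this double sum is twice the gap in Cauchy-Schwarz. *)
have : 0 <= \sum_(x in B) \sum_(y in B) (f x - f y) ^+ 2.
  by apply: sumr_ge0 => x _; apply: sumr_ge0 => y _; exact: sqr_ge0.
have -> : \sum_(x in B) \sum_(y in B) (f x - f y) ^+ 2
        = 2 * (#|B|%:R * q) - 2 * s ^+ 2.
  transitivity (\sum_(x in B) (#|B|%:R * f x ^+ 2 + q - 2 * s * f x)).
    apply: eq_bigr => x _.
    under eq_bigr do rewrite sqrrB -mulr_natl mulrA.
    rewrite big_split sumrB /= sumr_const -mulr_sumr -mulr_natl -/s -/q.
    ring.
  rewrite sumrB big_split /= -!mulr_sumr sumr_const -mulr_natl -/s -/q; ring.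
lra.
Qed.

Lemma code_bound (d : nat) (l : R) (C B : {set cube n}) f :
  is_code d C -> f != 0 -> {subset support f <= B} ->
  (forall x, 0 <= f x) -> (forall x, l * f x <= adjop f x) ->
  0 <= l - n%:R + 2 * d%:R ->
  (l - n%:R + 2 * d%:R) * #|C|%:R <= 2 * d%:R * #|B|%:R.
Proof.
move=> hC f0 fB fge0 fA k0.
have [->|C0] := eqVneq C finset.set0.
  by rewrite cards0 mulr0 !mulr_ge0.
have {}C0 : 0 < #|C|%:R :> R by rewrite ltr0n card_gt0.
have q0 := sum_sqr_gt0 f f0; have cs := sqr_sum_le_card B f fB.
set q := \sum_x _ in q0 cs; set s := \sum_x f x in cs.
pose S := \sum_(c in C) \sum_(c' in C) coef f c c' * coef f c c'.
have S_ge : #|C|%:R ^+ 2 * q <= S.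
  rewrite /S sum_coefM /q mulr_sumr; apply: ler_sum => x _.
  rewrite (bigD1 x) //= -[leLHS]addr0; apply: lerD.
    rewrite /kernel; under eq_bigr do rewrite chi_sqr.
    by rewrite sumr_const expr2 [leLHS]mulrC.
  by apply: sumr_ge0 => y _; apply: mulr_ge0; [exact: mulr_ge0 | exact: sqr_ge0].
have S_low : l * S <= \sum_(c in C) \sum_(c' in C) coef (adjop f) c c' * coef f c c'.
  rewrite /S !sum_coefM mulr_sumr; apply: ler_sum => x _.
  rewrite mulr_sumr; apply: ler_sum => y _.
  rewrite mulrA (mulrA l); apply: ler_wpM2r; first exact: sqr_ge0.
  exact: ler_wpM2r.
have S_up : \sum_(c in C) \sum_(c' in C) coef (adjop f) c c' * coef f c c'
    <= (n%:R - 2 * d%:R) * S + 2 * d%:R * (#|C|%:R * s ^+ 2).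
  have -> : #|C|%:R * s ^+ 2 =
      \sum_(c in C) \sum_(c' in C) (c' == c)%:R * (coef f c c' * coef f c c').
    rewrite mulr_natl -sumr_const; apply: eq_bigr => c cC.
    rewrite (bigD1 c) //= eqxx mul1r coef_diag -expr2 [X in _ + X]big1 ?addr0 //.
    by move=> c' /andP[_ /negPf ->]; rewrite mul0r.
  rewrite /S !mulr_sumr -big_split; apply: ler_sum => c cC /=.
  rewrite !mulr_sumr -big_split; apply: ler_sum => c' c'C /=.
  (* Without the common square, the claim is [n - 2 * hamming c c' <= n - 2 * d + 2 * d * (c' ==
     c)]; the minimal distance enters only off the diagonal. *)
  rewrite coef_adjop -[leLHS]mulrA [X in _ <= _ + X]mulrA -mulrDl.
  rewrite ler_wpM2r // -?expr2 ?sqr_ge0 //.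
  case: (eqVneq c' c) => [->|cc'] /=.
    have : 0 <= (hamming c c)%:R :> R by [].
    lra.
  have : d%:R <= (hamming c c')%:R :> R by rewrite ler_nat hC // eq_sym.
  lra.
rewrite -(ler_pM2r q0) -(ler_pM2r C0).
have h1 : (l - n%:R + 2 * d%:R) * (#|C|%:R ^+ 2 * q) <= (l - n%:R + 2 * d%:R) * S.
  exact: ler_wpM2l.
have h2 : (l - n%:R + 2 * d%:R) * S <= 2 * d%:R * (#|C|%:R * s ^+ 2) by lra.
have h3 : 2 * d%:R * (#|C|%:R * s ^+ 2) <= 2 * d%:R * (#|C|%:R * (#|B|%:R * q)).
  by rewrite ler_wpM2l ?mulr_ge0 // ler_wpM2l.
have := le_trans (le_trans h1 h2) h3; congr (_ <= _); ring.
Qed.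

(** * Extremal functions on [B] *)

(** The denominator is cleared to allow [f = 0], since a perturbed maximiser may vanish. *)
Lemma rayleigh_le (B : {set cube n}) f : B != finset.set0 ->
  {subset support f <= B} ->
  \sum_x adjop f x * f x <= lambda R B * \sum_x f x ^+ 2.
Proof.
move=> B0 fB; have [->|f0] := eqVneq f 0.
  rewrite !big1 ?mulr0 // => x _; by rewrite !ffunE ?mulr0 ?expr0n.
have q0 := sum_sqr_gt0 f f0; rewrite -ler_pdivrMr //.
apply: (lambda_is_max R B0).2; exists f; split=> //.
rewrite /inner -mulf_div divff ?mul1r; last by rewrite invr_neq0 // expf_neq0.
by under [X in _ = _ / X]eq_bigr do rewrite -expr2.
Qed.

(** Taking absolute values keeps the norm and does not lower the numerator, so the maximiser may be
    nonnegative. Off [B] only an inequality survives: [f] vanishes there, while [adjop f] need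
    not. *)
Lemma lambda_eigenfunction (B : {set cube n}) : B != finset.set0 ->
  exists f, [/\ f != 0, {subset support f <= B}, forall x, 0 <= f x &
    forall x, lambda R B * f x <= adjop f x].
Proof.
move=> B0; have [[g [g0 gB lg]] _] := lambda_is_max R B0.
pose f : {ffun cube n -> R} := [ffun x => `|g x|].
have fge0 x : 0 <= f x by rewrite ffunE.
have fsupp x : (f x == 0) = (g x == 0) by rewrite ffunE normr_eq0.
have f0 : f != 0.
  apply: contra g0 => /eqP/ffunP h; apply/eqP/ffunP => x.
  by rewrite ffunE; apply/eqP; rewrite -fsupp h ffunE.
have fB : {subset support f <= B} by move=> x; rewrite inE fsupp => /gB.
have fA0 x : 0 <= adjop f x by rewrite ffunE sumr_ge0.
have q0 := sum_sqr_gt0 f f0.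
have fmax : lambda R B * (\sum_x f x ^+ 2) <= \sum_x adjop f x * f x.
  have -> : \sum_x f x ^+ 2 = \sum_x g x ^+ 2.
    by apply: eq_bigr => x _; rewrite ffunE real_normK ?num_real.
  rewrite lg /inner -mulf_div divff ?mul1r; last by rewrite invr_neq0 // expf_neq0.
  under [X in _ / X * _ <= _]eq_bigr do rewrite -expr2.
  rewrite divfK ?gt_eqF ?sum_sqr_gt0 //; apply: ler_sum => x _.
  rewrite (le_trans (ler_norm _)) // normrM [X in _ <= _ * X]ffunE ler_wpM2r //.
  rewrite !ffunE (le_trans (ler_norm_sum _ _ _)) //.
  by apply: ler_sum => y _; rewrite ffunE.
exists f; split=> // b; have [bB|bB] := boolP (b \in B); last first.
  have /eqP-> : f b == 0 by apply: contraNT bB => /fB.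
  by rewrite mulr0.
(* First-order optimality: perturb the maximiser [f] by a multiple of the point mass at [b]. *)
have perturb t : 2 * t * (adjop f b - lambda R B * f b) <= lambda R B * t ^+ 2.
  pose e : {ffun cube n -> R} := [ffun x => (x == b)%:R].
  pose h : {ffun cube n -> R} := [ffun x => f x + t * e x].
  have hB : {subset support h <= B}.
    move=> x; rewrite inE [h x]ffunE [e x]ffunE; have [->//|_] := eqVneq x b.
    by rewrite mulr0 addr0; exact: fB.
  have sum_e (u : cube n -> R) : \sum_x u x * e x = u b.
    rewrite (bigD1 b) //= ffunE eqxx mulr1 big1 ?addr0 // => x /negPf xb.
    by rewrite ffunE xb mulr0.
  have hA x : adjop h x = adjop f x + t * adjop e x.
    rewrite !ffunE mulr_sumr -big_split; by apply: eq_bigr => y _; rewrite ffunE.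
  (* No point is its own neighbour, so the numerator gains no term in [t ^+ 2]. *)
  have eb : adjop e b = 0.
    rewrite ffunE big1 // => y; rewrite ffunE; have [->|//] := eqVneq y b.
    by rewrite adjacentE => /imsetP[i _ /ffunP/(_ i)]; rewrite ffunE eqxx; case: (b i).
  have := rayleigh_le B h B0 hB.
  have -> : \sum_x h x ^+ 2 = \sum_x f x ^+ 2 + 2 * t * f b + t ^+ 2.
    transitivity (\sum_x (f x ^+ 2 + 2 * t * (f x * e x) + t ^+ 2 * (e x * e x))).
      by apply: eq_bigr => x _; rewrite [h x]ffunE; ring.
    by rewrite !big_split /= -!mulr_sumr !sum_e [e b]ffunE eqxx mulr1.
  have -> : \sum_x adjop h x * h x = \sum_x adjop f x * f x + 2 * t * adjop f b.
    transitivity (\sum_x (adjop f x * f x + t * (adjop f x * e x)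
        + t * (adjop e x * f x) + t ^+ 2 * (adjop e x * e x))).
      by apply: eq_bigr => x _; rewrite hA [h x]ffunE; ring.
    have ef : \sum_x adjop e x * f x = adjop f b.
      rewrite adjop_sym -sum_e; by apply: eq_bigr => x _; rewrite mulrC.
    by rewrite !big_split /= -!mulr_sumr !sum_e ef eb; ring.
  lra.
have l0 : 0 <= lambda R B.
  rewrite -(pmulr_lge0 _ q0) (le_trans _ (rayleigh_le B f B0 fB)) //.
  by apply: sumr_ge0 => x _; rewrite mulr_ge0.
rewrite -subr_ge0 leNgt; apply/negP; have := perturb.
set r := _ - _ => h r0; set l := lambda R B in l0 h.
have l1 : l + 1 != 0 by rewrite gt_eqF // ltr_wpDl.
(* This [t] turns the bound into [(l + 2) * u ^+ 2 <= 0], a contradiction. The optimal [r / l] is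
   avoided because [l] may be 0. *)
have := h (r / (l + 1)); set u := r / _.
have er : r = u * (l + 1) by rewrite /u divfK.
have u0 : 0 < u ^+ 2 by rewrite exprn_even_gt0 // mulf_neq0 ?invr_eq0 // lt_eqF.
have : 0 <= l * u ^+ 2 by rewrite mulr_ge0 // ltW.
rewrite er; lra.
Qed.

End Characters.

Theorem proposition1p1 (R : realType) (n d : nat) (C B : {set cube n})
  (hn : (0 < n)%N)
  (hC : is_code d C)
  (hB : B != finset.set0)
  (hlambda : n%:R - 2 * d%:R + 1 <= lambda R B)
  (* excludes n = 2d - 1 with B a single point, where the bound fails *)
  (hexc : (n.+1 = 2 * d)%N -> (1 < #|B|)%N) :
  (#|C| <= n * #|B|)%N.
Proof.
have [d_small|d_large] := leqP (2 * d) n.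
  have [f [f0 fB fge0 fA]] := lambda_eigenfunction R n B hB.
  have k1 : 1 <= lambda R B - n%:R + 2 * d%:R by lra.
  have bound := code_bound R n d _ C B f hC f0 fB fge0 fA (le_trans ler01 k1).
  have : (#|C| <= 2 * d * #|B|)%N.
    by rewrite -(ler_nat R) !natrM (le_trans _ bound) // ler_peMl.
  by move=> h; apply: (leq_trans h); rewrite leq_mul2r d_small orbT.
have [b bB] := set0Pn _ hB.
have plotkin : ((2 * d - n) * #|C| <= 2 * d)%N.
  pose e : {ffun cube n -> R} := [ffun x => (x == b)%:R].
  have e0 : e != 0.
    by apply/eqP => /ffunP/(_ b)/eqP; rewrite !ffunE eqxx oner_eq0.
  have eb : {subset support e <= [set b]%SET}.
    by move=> x; rewrite !inE ffunE; case: (x == b); rewrite //= eqxx.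
  have ege0 x : 0 <= e x by rewrite ffunE.
  have eA x : 0 * e x <= adjop e x by rewrite mul0r ffunE sumr_ge0.
  have dn : n%:R <= 2 * d%:R :> R by rewrite -natrM ler_nat ltnW.
  have k0 : 0 <= 0 - n%:R + 2 * d%:R :> R by lra.
  have := code_bound R n d 0 C _ e hC e0 eb ege0 eA k0.
  rewrite cards1 mulr1 sub0r addrC -natrM -natrB ?(ltnW d_large) //.
  by rewrite -natrM ler_nat.
have B1 : (0 < #|B|)%N by rewrite card_gt0.
have [n2d|n2d] := eqVneq n.+1 (2 * d)%N.
  (* Here [#|C| <= n + 1 <= 2 * n <= n * #|B|]. *)
  have := hexc n2d => B2; rewrite -n2d subSn // subnn mul1n in plotkin.
  nia.
have [k [k2 ek]] : exists k, (1 < k /\ 2 * d = n + k)%N.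
  exists (2 * d - n)%N; lia.
rewrite ek addKn in plotkin.
(* If [#|C| >= n + 1], then [k * (n + 1) <= n + k], so [k * n <= n], contradicting [1 < k] and
   [0 < n]. *)
have Cn : (#|C| <= n)%N by nia.
by apply: (leq_trans Cn); rewrite leq_pmulr.
Qed.
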